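(* Let $\mathbf{L}^1,\mathbf{L}^2\in\mathcal{B}$ and let $\epsilon$ be a real number with $d(\mathbf{L}^1,\mathbf{L}^2)\le\epsilon$. Then for any $\mathbf{M}^1\in\Phi^{-1}(\mathbf{L}^1)$ with total support, there exist an $\mathbf{M}^2\in\Phi^{-1}(\mathbf{L}^2)$ and a constant $C$ such that $d(\mathbf{M}^1,\mathbf{M}^2)\le C\cdot\epsilon$.
   Context: All matrices are real, non-negative and have no zero rows or zero columns. The distance between $n\times n$ matrices is the maximum entrywise difference, $d(A,B)=\max_{i,j}|a_{ij}-b_{ij}|$. For an $n\times n$ matrix $A=(a_{ij})$ and $\sigma\in S_n$, the set $\{a_{1,\sigma(1)},\dots,a_{n,\sigma(n)}\}$ is a diagonal of $A$; it is positive if all $a_{i,\sigma(i)}>0$. $A$ has total support if every positive entry of $A$ is contained in a positive diagonal. $\mathcal{A}$ is the set of $n\times n$ matrices with at least one positive diagonal and $\mathcal{B}$ is the set of $n\times n$ doubly stochastic matrices. Sinkhorn (SK) iteration of $\mathbf{M}$ alternately normalizes rows (dividing each row by its sum) and columns (dividing each column by its sum), starting with rows. By Sinkhorn and Knopp, for $\mathbf{M}\in\mathcal{A}$ it converges to a unique $\mathbf{M}^*\in\mathcal{B}$; $\Phi:\mathcal{A}\to\mathcal{B}$ is $\Phi(\mathbf{M})=\mathbf{M}^*$ and $\Phi^{-1}(\mathbf{L})=\{\mathbf{M}\in\mathcal{A}:\Phi(\mathbf{M})=\mathbf{L}\}$. *)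

(* Defs.v *)
From HB Require Import structures.
From mathcomp Require Import all_boot all_order all_fingroup all_algebra.
From mathcomp Require Import all_classical all_reals all_analysis.

Set Implicit Arguments.
Unset Strict Implicit.
Unset Printing Implicit Defensive.

Import Order.TTheory GRing.Theory Num.Theory.
Import numFieldNormedType.Exports.

Local Open Scope classical_set_scope.
Local Open Scope ring_scope.

Section Sinkhorn.
Variables (R : realType) (n : nat).
Implicit Types A M L : 'M[R]_n.

Definition admissible A : Prop :=
  [/\ forall i j, 0 <= A i j,
      forall i, exists j, A i j != 0
    & forall j, exists i, A i j != 0].

(** The norm of a matrix is [mx_norm], the maximum of the absolute values of its
    entries. *)
Definition mxdist A B : R := `|A - B|.

Definition positive_diagonal A (s : 'S_n) : Prop := forall i, 0 < A i (s i).

Definition total_support A : Prop :=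
  forall i j, 0 < A i j -> exists2 s : 'S_n, positive_diagonal A s & s i = j.

Definition has_positive_diagonal : set 'M[R]_n :=
  [set A | admissible A /\ exists s : 'S_n, positive_diagonal A s].

Definition doubly_stochastic : set 'M[R]_n :=
  [set A | [/\ admissible A,
               forall i, \sum_j A i j = 1
             & forall j, \sum_i A i j = 1]].

Definition normalize_rows A : 'M[R]_n :=
  \matrix_(i, j) (A i j / \sum_k A i k).

Definition normalize_cols A : 'M[R]_n :=
  \matrix_(i, j) (A i j / \sum_k A k j).

(** Every half-step counts as one iterate: the step from an even index normalizes
    the rows, the step from an odd index the columns. *)
Fixpoint sinkhorn M (k : nat) : 'M[R]_n :=
  if k is k'.+1 then
    if odd k' then normalize_cols (sinkhorn M k')
    else normalize_rows (sinkhorn M k')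
  else M.

(** [lim] returns a default value on a divergent sequence. By the Sinkhorn-Knopp
    theorem the iteration converges when [M] has a positive diagonal, and
    [sinkhorn_preimage] only contains such matrices. *)
Definition sinkhorn_limit M : 'M[R]_n := lim (sinkhorn M k @[k --> \oo]).

Definition sinkhorn_preimage L : set 'M[R]_n :=
  has_positive_diagonal `&` sinkhorn_limit @^-1` [set L].

End Sinkhorn.

(* Main.v *)
(** Sinkhorn-Knopp: the iterates of [M1] are diagonal rescalings of [M1], so for
    total support the limit is [L1 = D M1 E] with [D], [E] positive diagonal, and
    [M2 := D^-1 L2 E^-1] works, with the constant depending on [D] and [E] only.

    For convergence, the logarithm of the product of a positive diagonal increases
    along the iteration by an amount that controls the deviation of the line sums
    from 1, so these deviations vanish, and by total support the positive entries
    stay away from 0. If [A i j = B i j * exp (u i + v j)] has entries in [0, 1],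
    as has [B], then
      [(A i j - B i j)^2 <= sum_ij (A i j - B i j) (u i + v j)],
    and the right-hand side only involves [u], [v] and the line sums of [A] and [B].
    For two late iterates this shows that the iteration is Cauchy; for two doubly
    stochastic matrices it shows [A = B], which identifies the limit of [M2]. *)

From HB Require Import structures.
Require Import Defs.
From mathcomp Require Import all_boot all_order all_fingroup all_algebra.
From mathcomp Require Import all_classical all_reals all_analysis.
From mathcomp Require Import ring lra.
Import numFieldNormedType.Exports.
Import Order.TTheory GRing.Theory Num.Theory.
Local Open Scope classical_set_scope.
Local Open Scope ring_scope.
Set Implicit Arguments.
Unset Strict Implicit.
Unset Printing Implicit Defensive.

(** * Positive diagonals of doubly stochastic matrices *)

(** A simple path from [j] to [i] closes into a cycle through the edge from [i] to [j]; [s] moves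
    each vertex of the cycle to its successor and fixes the rest. *)
Lemma cycle_perm (T : finType) (e : rel T) i j :
  e i j -> connect e j i ->
  exists2 s : {perm T}, s i = j & forall k, s k = k \/ e k (s k).
Proof.
move=> eij /connectP[p0 ep0 def_i]; move: eij; rewrite def_i.
case/shortenP: ep0 => p ep Up _ {def_i p0} elj.
have cycp : path.cycle e (j :: p) by rewrite /= rcons_path ep.
pose s := perm (can_inj (prev_next Up)).
exists s.
  rewrite permE -[RHS](next_prev Up) prev_nth mem_head.
  by have /andP[jp _] := Up; rewrite (memNindex jp) (nth_last j (j :: p)).
move=> k; rewrite permE; case: (boolP (k \in j :: p)) => kp.
  by right; exact: next_cycle.
by left; rewrite next_nth (negbTE kp).
Qed.

(* The rows reachable from [j] carry their whole mass in the columns reachable from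
   [j]; these columns are then saturated, so no outside row can meet them. *)
Lemma doubly_stochastic_connect (R : realType) (n : nat) (L : 'M[R]_n) i j :
  doubly_stochastic L -> 0 < L i j -> connect (fun a b => 0 < L a b) j i.
Proof.
move=> [[L0 _ _] Lr Lc] Lij; set e := fun a b => 0 < L a b.
pose S := [set a | connect e j a]%SET.
have jS : j \in S by rewrite inE.
apply: contraPT (Lij) => nji; have iS : i \notin S by rewrite inE.
have zero a b : a \in S -> b \notin S -> L a b = 0.
  rewrite !inE => ja njb; apply/eqP; rewrite eq_sym -[_ == _]negbK.
  apply: contra njb => ?; apply: connect_trans ja (connect1 _).
  by rewrite /e lt_neqAle L0 andbT.
have sumS : \sum_(a in S) \sum_(b in S) L a b = \sum_(a in S) 1.
  apply: eq_bigr => a aS; rewrite -(Lr a) [RHS](bigID (mem S)) /=.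
  by rewrite [X in _ = _ + X]big1 ?addr0 // => b; exact: zero.
have : \sum_(a | a \notin S) \sum_(b in S) L a b = 0.
  apply: (addrI (\sum_(a in S) \sum_(b in S) L a b)).
  rewrite -(bigID (mem S) xpredT) /= exchange_big addr0 sumS.
  by apply: eq_bigr => b _; exact: Lc.
move/eqP; rewrite psumr_eq0 => [/allP|a _]; last exact: sumr_ge0.
move=> /(_ i (mem_index_enum _)); rewrite iS psumr_eq0 // => /allP.
move=> /(_ j (mem_index_enum _)); rewrite jS => /eqP ->.
by rewrite ltxx.
Qed.

Lemma doubly_stochastic_col_perm (R : realType) (n : nat) (L : 'M[R]_n) (s : 'S_n) :
  doubly_stochastic L -> doubly_stochastic (col_perm s L).
Proof.
move=> [[L0 Lr0 Lc0] Lr Lc]; split=> [|i|j]; first split=> [i j|i|j].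
- by rewrite mxE.
- by have [j Lij] := Lr0 i; exists (s^-1 j)%g; rewrite mxE permKV.
- by have [i Lij] := Lc0 (s j); exists i; rewrite mxE.
- rewrite -[RHS](Lr i) [RHS](reindex_perm s) /=.
  by apply: eq_bigr => j _; rewrite mxE.
- by rewrite -[RHS](Lc (s j)); apply: eq_bigr => i _; rewrite mxE.
Qed.

(* After permuting columns so that [s] becomes the identity, the entry [(i, j)] lies
   on a cycle of positive entries, along which [s] is rotated. *)
Lemma doubly_stochastic_reroute (R : realType) (n : nat) (L : 'M[R]_n) (s : 'S_n)
    i j :
  doubly_stochastic L -> 0 < L i j ->
  exists2 s' : 'S_n, s' i = j & forall k, s' k = s k \/ 0 < L k (s' k).
Proof.
move=> dsL Lij; set e := fun a b => 0 < col_perm s L a b.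
have eij : e i (s^-1 j)%g by rewrite /e mxE permKV.
have ds' := doubly_stochastic_col_perm s dsL.
have [t ti et] := cycle_perm eij (doubly_stochastic_connect ds' eij).
exists (t * s)%g => [|k]; first by rewrite permM ti permKV.
by rewrite permM; case: (et k) => [->|]; [left | rewrite /e mxE; right].
Qed.

(** A permutation with the most positive entries works: a zero entry in row [i] could be rerouted
    through a positive entry of that row without losing any of the others. *)
Lemma doubly_stochastic_positive_diagonal (R : realType) (n : nat) (L : 'M[R]_n) :
  doubly_stochastic L -> exists s : 'S_n, positive_diagonal L s.
Proof.
move=> dsL; pose good (s : 'S_n) := [set i | 0 < L i (s i)]%SET.
have [s _ smax] := @arg_maxnP _ 1%g xpredT (fun s => #|good s|) isT.
exists s => i; apply: contraTT isT => nLi.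
have [[L0 Lr0 _] _ _] := dsL.
have [j Lij] := Lr0 i; have {}Lij : 0 < L i j by rewrite lt_neqAle eq_sym Lij L0.
have [s' s'i s's] := doubly_stochastic_reroute s dsL Lij.
suff : (#|good s| < #|good s'|)%N by move=> lt_ss'; have := smax s' isT; rewrite /= leqNgt lt_ss'.
apply: proper_card; apply/properP; split.
  by apply/fintype.subsetP => k; rewrite !inE; case: (s's k) => [->|->].
by exists i; rewrite !inE ?s'i.
Qed.

Lemma doubly_stochastic_total_support (R : realType) (n : nat) (L : 'M[R]_n) :
  doubly_stochastic L -> total_support L.
Proof.
move=> dsL i j Lij; have [s sL] := doubly_stochastic_positive_diagonal dsL.
have [s' s'i s's] := doubly_stochastic_reroute s dsL Lij.
by exists s' => // k; case: (s's k) => [->|].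
Qed.

(** * Comparison of diagonal scalings *)

(** Two uses of [1 + x <= expR x] give [b * z <= a - b <= a * z]; as [a] and [b] lie in [0, 1],
    [a - b] has the sign of [z] and is at most [z] in absolute value. *)
Lemma sqrB_le_expR (R : realType) (a b z : R) :
  0 <= a <= 1 -> 0 <= b <= 1 -> a = b * expR z -> (a - b) ^+ 2 <= (a - b) * z.
Proof.
move=> /andP[a0 a1] /andP[b0 b1] def_a.
have ble : b * z <= a - b.
  by rewrite lerBrDr addrC def_a -[X in X + _]mulr1 -mulrDr ler_wpM2l // expR_ge1Dx.
have ale : a - b <= a * z.
  have -> : b = a * expR (- z) by rewrite def_a -mulrA -expRD subrr expR0 mulr1.
  rewrite lerBlDr addrC -lerBlDr -[X in X - _]mulr1 -mulrBr ler_wpM2l //.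
  by rewrite (le_trans _ (expR_ge1Dx _)).
rewrite expr2; case: (lerP 0 z) => z0.
  rewrite ler_wpM2l //; first by rewrite (le_trans _ ble) ?mulr_ge0.
  by rewrite (le_trans ale) // ler_piMl.
rewrite ler_wnM2l //.
  by rewrite (le_trans ale) // mulr_ge0_le0 // ltW.
by rewrite (le_trans _ ble) // -[leLHS]mul1r ler_wnM2r // ltW.
Qed.

(** The right-hand side regroups into a sum over all entries of [(A i j - B i j) * (u i + v j)].
    Each term is at least a square, so the sum bounds any single one. *)
Lemma scaled_sqrB_le (R : realType) (n : nat) (A B : 'M[R]_n) (u v : 'I_n -> R) :
  (forall i j, 0 <= A i j <= 1) -> (forall i j, 0 <= B i j <= 1) ->
  (forall i j, A i j = B i j * expR (u i + v j)) ->
  forall i j, (A i j - B i j) ^+ 2 <=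
    \sum_i u i * (\sum_j A i j - \sum_j B i j) +
    \sum_j v j * (\sum_i A i j - \sum_i B i j).
Proof.
move=> A01 B01 AB i j.
have -> : \sum_i u i * (\sum_j A i j - \sum_j B i j) +
    \sum_j v j * (\sum_i A i j - \sum_i B i j) =
    \sum_i \sum_j (A i j - B i j) * (u i + v j).
  have -> : \sum_j v j * (\sum_i A i j - \sum_i B i j) =
      \sum_i \sum_j (A i j - B i j) * v j.
    rewrite exchange_big; apply: eq_bigr => b _ /=.
    by rewrite mulrC -sumrB mulr_suml.
  rewrite -big_split; apply: eq_bigr => a _ /=.
  rewrite mulrC -sumrB mulr_suml -big_split; apply: eq_bigr => b _ /=.
  by rewrite mulrDr.
have term a b : (A a b - B a b) ^+ 2 <= (A a b - B a b) * (u a + v b).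
  exact: sqrB_le_expR.
have term0 a b : 0 <= (A a b - B a b) * (u a + v b).
  exact: le_trans (sqr_ge0 _) (term a b).
apply: le_trans (term i j) _; rewrite (bigD1 i) //= (bigD1 j) //= -addrA lerDl.
by rewrite addr_ge0 ?sumr_ge0 // => a _; rewrite sumr_ge0.
Qed.

Lemma doubly_stochastic_le1 (R : realType) (n : nat) (L : 'M[R]_n) i j :
  doubly_stochastic L -> 0 <= L i j <= 1.
Proof.
move=> [[L0 _ _] Lr _]; rewrite L0 -(Lr i) (bigD1 j) //= lerDl.
exact: sumr_ge0.
Qed.

(** Equal line sums make the bound of [scaled_sqrB_le] zero. *)
Lemma doubly_stochastic_scaled_eq (R : realType) (n : nat) (A L : 'M[R]_n)
    (u v : 'I_n -> R) :
  doubly_stochastic A -> doubly_stochastic L ->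
  (forall i j, A i j = L i j * expR (u i + v j)) -> A = L.
Proof.
move=> dsA dsL AL; have [_ Ar Ac] := dsA; have [_ Lr Lc] := dsL.
apply/matrixP => i j; apply/eqP; rewrite -subr_eq0 -sqrf_eq0 eq_le sqr_ge0 andbT.
have /le_trans -> // := scaled_sqrB_le (fun a b => doubly_stochastic_le1 a b dsA)
  (fun a b => doubly_stochastic_le1 a b dsL) AL i j.
rewrite !big1 ?addr0 // => k _.
  by rewrite Ac Lc subrr mulr0.
by rewrite Ar Lr subrr mulr0.
Qed.

(* [u] and [v] are not determined by their sums on [S], and may be unbounded when
   the sums are bounded; a linear choice is bounded and passes to the limit. *)
Lemma potentials_linear_choice (R : realType) (n : nat) (S : 'I_n -> 'I_n -> bool) :
  exists P Q : 'I_n -> 'I_n -> 'I_n -> R,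
    forall (w : 'I_n -> 'I_n -> R) (u v : 'I_n -> R),
    (forall i j, S i j -> w i j = u i + v j) ->
    forall i j, S i j ->
      w i j = (\sum_a \sum_(b | S a b) w a b * P i a b) +
              (\sum_a \sum_(b | S a b) w a b * Q j a b).
Proof.
pose f (z : 'rV[R]_n * 'rV[R]_n) : 'M[R]_n :=
  \matrix_(i, j) ((S i j)%:R * (z.1 0 i + z.2 0 j)).
have lin_f : linear f.
  by move=> k x y; apply/matrixP => i j; rewrite !mxE /=; ring.
pose F := GRing.isLinear.Build _ _ _ _ f lin_f.
pose fl : {linear _ -> _} := HB.pack f F.
(* [g] inverts [f] on its image only, which gives [f (g (f z)) = f z]: it picks potentials with the
   prescribed sums on [S], linearly in those sums. *)
pose g := (linfun fl)^-1%VF.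
exists (fun i a b => (g (delta_mx a b)).1 0 i), (fun j a b => (g (delta_mx a b)).2 0 j).
move=> w u v wE i j Sij.
pose z := (\row_i u i, \row_j v j) : 'rV[R]_n * 'rV[R]_n.
have fz a b : f z a b = (S a b)%:R * w a b.
  rewrite mxE /= !mxE; case: (boolP (S a b)) => [Sab|_]; last by rewrite !mul0r.
  by rewrite wE.
have fgf : f (g (f z)) = f z.
  have lz : linfun fl z = f z by rewrite lfunE.
  by rewrite -[RHS]lz -[RHS](limg_lfunVK (memv_img _ (memvf z))) !lfunE.
have gE : g (f z) = \sum_a \sum_(b | S a b) w a b *: g (delta_mx a b).
  rewrite {1}(matrix_sum_delta (f z)) linear_sum; apply: eq_bigr => a _.
  rewrite linear_sum [RHS]big_mkcond; apply: eq_bigr => b _.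
  by rewrite linearZ /= fz; case: (S a b); rewrite ?mul1r ?mul0r ?scale0r.
have := congr1 (fun A : 'M[R]_n => A i j) fgf.
rewrite fz Sij mul1r => <-; rewrite mxE Sij mul1r gE; congr (_ + _).
  rewrite raddf_sum summxE; apply: eq_bigr => a _.
  by rewrite raddf_sum summxE; apply: eq_bigr => b _; rewrite /= mxE.
rewrite raddf_sum summxE; apply: eq_bigr => a _.
by rewrite raddf_sum summxE; apply: eq_bigr => b _; rewrite /= mxE.
Qed.

(** Since the [c i] sum to [n], the sum of the [- ln (c i)] equals that of the nonnegative terms
    [c i - 1 - ln (c i)]. *)
Lemma sum_ln_defect (R : realType) (n : nat) (c : 'I_n -> R) :
  (forall i, 0 < c i) -> \sum_i c i = n%:R ->
  0 <= - \sum_i ln (c i) /\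
  forall i, (c i - 1) ^+ 2 <= n.+2%:R ^+ 2 * - \sum_i ln (c i).
Proof.
move=> c0 sumc.
pose h i := c i - 1 - ln (c i).
have -> : - \sum_i ln (c i) = \sum_i h i.
  rewrite /h !sumrB sumc sumr_const card_ord.
  by rewrite subrr add0r.
(* With [q = sqrt c], [c - 1 - ln c >= q ^ 2 - 1 - 2 (q - 1) = (q - 1) ^ 2]. *)
have hle i : exists2 q : R, 0 < q /\ q ^+ 2 = c i & (q - 1) ^+ 2 <= h i.
  pose z := ln (c i) / 2; have lnz : ln (c i) = z + z by rewrite -splitr.
  have qc : expR z ^+ 2 = c i by rewrite expr2 -expRD -lnz lnK // posrE.
  exists (expR z); first by split; first exact: expR_gt0.
  by rewrite /h lnz -qc; have := expR_ge1Dx z; lra.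
have h0 i : 0 <= h i by have [q _] := hle i; apply: le_trans; exact: sqr_ge0.
split=> [|i]; first exact: sumr_ge0.
have [q [q0 qc] qh] := hle i.
have hs : h i <= \sum_i h i by rewrite (bigD1 i) //= lerDl sumr_ge0.
have cn : c i <= n%:R by rewrite -sumc (bigD1 i) //= lerDl sumr_ge0 // => k _; exact: ltW.
have n0 : 0 <= n%:R :> R by [].
rewrite -qc; have -> : q ^+ 2 - 1 = (q + 1) * (q - 1) by ring.
rewrite exprMn ler_pM ?sqr_ge0 //; last exact: le_trans qh hs.
rewrite ler_sqr ?nnegrE //; last by rewrite addr_ge0 // ltW.
(* From [q ^+ 2 = c i <= n] follows [q + 1 <= n + 2], the source of the constant. *)
by rewrite -[n.+2]addn1 natrD lerD2r -natr1; nra.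
Qed.

(** * Sinkhorn iterates as positive diagonal scalings *)

Lemma normalize_cols_tr (R : realType) (n : nat) (A : 'M[R]_n) :
  normalize_cols A = (normalize_rows A^T)^T.
Proof.
apply/matrixP => i j; rewrite !mxE; congr (_ / _).
by apply: eq_bigr => k _; rewrite mxE.
Qed.

Lemma admissible_tr (R : realType) (n : nat) (A : 'M[R]_n) :
  admissible A -> admissible A^T.
Proof.
move=> [A0 Ar Ac]; split=> [i j|i|j]; first by rewrite mxE.
  by have [j Aji] := Ac i; exists j; rewrite mxE.
by have [i Aji] := Ar j; exists i; rewrite mxE.
Qed.

Lemma admissible_row_sum_gt0 (R : realType) (n : nat) (A : 'M[R]_n) i :
  admissible A -> 0 < \sum_j A i j.
Proof.
move=> [A0 Ar _]; have [j Aij] := Ar i.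
rewrite (bigD1 j) //= ltr_pwDl ?sumr_ge0 // lt_neqAle eq_sym Aij.
exact: A0.
Qed.

Lemma normalize_rows_row_sum (R : realType) (n : nat) (A : 'M[R]_n) i :
  admissible A -> \sum_j normalize_rows A i j = 1.
Proof.
move=> adA; under eq_bigr do rewrite mxE.
by rewrite -mulr_suml divff // gt_eqF // admissible_row_sum_gt0.
Qed.

Lemma normalize_rows_scaled (R : realType) (n : nat) (A : 'M[R]_n) i j :
  admissible A ->
  normalize_rows A i j = A i j * expR (- ln (\sum_k A i k)).
Proof.
by move=> adA; rewrite mxE expRN lnK // posrE admissible_row_sum_gt0.
Qed.

Lemma scaled_eq0 (R : realType) (n : nat) (A M : 'M[R]_n) (u v : 'I_n -> R) :
  (forall i j, A i j = M i j * expR (u i + v j)) ->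
  forall i j, (A i j == 0) = (M i j == 0).
Proof.
by move=> AM i j; rewrite AM mulf_eq0 [X in _ || X]gt_eqF ?expR_gt0 // orbF.
Qed.

Lemma scaled_gt0 (R : realType) (n : nat) (A M : 'M[R]_n) (u v : 'I_n -> R) :
  (forall i j, A i j = M i j * expR (u i + v j)) ->
  forall i j, (0 < A i j) = (0 < M i j).
Proof. by move=> AM i j; rewrite AM pmulr_lgt0 ?expR_gt0. Qed.

Lemma scaled_admissible (R : realType) (n : nat) (A M : 'M[R]_n) (u v : 'I_n -> R) :
  (forall i j, A i j = M i j * expR (u i + v j)) -> admissible M -> admissible A.
Proof.
move=> AM [M0 Mr Mc]; split=> [i j|i|j].
- by rewrite AM mulr_ge0 ?expR_ge0.
- by have [j Mij] := Mr i; exists j; rewrite (scaled_eq0 AM).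
- by have [i Mij] := Mc j; exists i; rewrite (scaled_eq0 AM).
Qed.

Lemma scaled_total_support (R : realType) (n : nat) (A M : 'M[R]_n)
    (u v : 'I_n -> R) :
  (forall i j, A i j = M i j * expR (u i + v j)) ->
  total_support M -> total_support A.
Proof.
move=> AM tsM i j; rewrite (scaled_gt0 AM) => /tsM[s sM si].
by exists s => // k; rewrite (scaled_gt0 AM).
Qed.

(** Each half-step subtracts the logarithms of the line sums from one of the two potentials. *)
Lemma sinkhorn_scaled (R : realType) (n : nat) (M : 'M[R]_n) k :
  admissible M ->
  exists u v, forall i j, sinkhorn M k i j = M i j * expR (u i + v j).
Proof.
move=> adM; elim: k => [|k [u [v IH]]].
  by exists (fun=> 0), (fun=> 0) => i j; rewrite addr0 expR0 mulr1.
have adA := scaled_admissible IH adM; rewrite /=; case: (odd k).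
  exists u, (fun j => v j - ln (\sum_i sinkhorn M k i j)) => i j.
  rewrite normalize_cols_tr mxE normalize_rows_scaled; last exact: admissible_tr.
  rewrite mxE IH addrA [in RHS]expRD mulrA; congr (_ * expR (- ln _)).
  by apply: eq_bigr => a _; rewrite mxE.
exists (fun i => u i - ln (\sum_j sinkhorn M k i j)), v => i j.
by rewrite normalize_rows_scaled // IH addrAC [in RHS]expRD mulrA.
Qed.

Lemma sinkhorn_admissible (R : realType) (n : nat) (M : 'M[R]_n) k :
  admissible M -> admissible (sinkhorn M k).
Proof.
by move=> adM; have [u [v AM]] := sinkhorn_scaled k adM; exact: scaled_admissible AM adM.
Qed.

Lemma sinkhorn_gt0 (R : realType) (n : nat) (M : 'M[R]_n) k i j :
  admissible M -> (0 < sinkhorn M k i j) = (0 < M i j).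
Proof.
by move=> adM; have [u [v AM]] := sinkhorn_scaled k adM; rewrite (scaled_gt0 AM).
Qed.

Lemma sinkhorn_row_sum (R : realType) (n : nat) (M : 'M[R]_n) k i :
  admissible M -> ~~ odd k -> \sum_j sinkhorn M k.+1 i j = 1.
Proof.
move=> adM /negbTE /= ->; apply: normalize_rows_row_sum.
exact: sinkhorn_admissible.
Qed.

Lemma sinkhorn_col_sum (R : realType) (n : nat) (M : 'M[R]_n) k j :
  admissible M -> odd k -> \sum_i sinkhorn M k.+1 i j = 1.
Proof.
move=> adM /= ->; rewrite normalize_cols_tr; under eq_bigr do rewrite mxE.
by apply/normalize_rows_row_sum/admissible_tr/sinkhorn_admissible.
Qed.

(** The index starts at 1: a half-step makes all rows, or all columns, sum to 1. *)
Lemma sinkhorn_le1 (R : realType) (n : nat) (M : 'M[R]_n) k i j :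
  admissible M -> 0 <= sinkhorn M k.+1 i j <= 1.
Proof.
move=> adM; have [A0 _ _] := sinkhorn_admissible k.+1 adM; rewrite A0 andTb.
case: (boolP (odd k)) => ok.
  rewrite -(sinkhorn_col_sum j adM ok) [leRHS](bigD1 i) // lerDl.
  by apply: sumr_ge0 => a _; exact: A0.
rewrite -(sinkhorn_row_sum i adM ok) [leRHS](bigD1 j) // lerDl.
by apply: sumr_ge0 => b _; exact: A0.
Qed.

(** * Growth of diagonal products along the iteration *)

(** The logarithm of the product along [s] when that diagonal is positive; elsewhere [ln] takes the
    default value 0. *)
Definition ln_diagonal (R : realType) (n : nat) (s : 'S_n) (A : 'M[R]_n) : R :=
  \sum_i ln (A i (s i)).

Lemma ln_diagonal_tr (R : realType) (n : nat) (s : 'S_n) (A : 'M[R]_n) :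
  ln_diagonal s^-1 A^T = ln_diagonal s A.
Proof.
rewrite /ln_diagonal (reindex_perm s); apply: eq_bigr => i _ /=.
by rewrite mxE permK.
Qed.

(** A diagonal meets each row once, so the gain is the same for every positive [s]. *)
Lemma ln_diagonal_normalize_rows (R : realType) (n : nat) (s : 'S_n) (A : 'M[R]_n) :
  admissible A -> positive_diagonal A s ->
  ln_diagonal s (normalize_rows A) - ln_diagonal s A =
    - \sum_i ln (\sum_j A i j).
Proof.
move=> adA sA; rewrite /ln_diagonal -sumrB -sumrN; apply: eq_bigr => i _.
by rewrite normalize_rows_scaled // lnM ?posrE ?sA ?expR_gt0 // expRK addrAC subrr add0r.
Qed.

Lemma normalize_rows_defect (R : realType) (n : nat) (s : 'S_n) (A : 'M[R]_n) :
  admissible A -> positive_diagonal A s -> (forall j, \sum_i A i j = 1) ->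
  let g := ln_diagonal s (normalize_rows A) - ln_diagonal s A in
  0 <= g /\ forall i, (\sum_j A i j - 1) ^+ 2 <= n.+2%:R ^+ 2 * g.
Proof.
move=> adA sA Ac g; rewrite /g ln_diagonal_normalize_rows //.
apply: sum_ln_defect => [i|]; first exact: admissible_row_sum_gt0.
by rewrite exchange_big /= (eq_bigr _ (fun j _ => Ac j)) sumr_const card_ord.
Qed.

(** From index 1 on, one family of line sums equals 1 and the next half-step normalizes the other,
    so the gain [g] controls both. *)
Lemma sinkhorn_defect (R : realType) (n : nat) (M : 'M[R]_n) (s : 'S_n) k :
  admissible M -> positive_diagonal M s ->
  let A := sinkhorn M k.+1 in
  let g := ln_diagonal s (sinkhorn M k.+2) - ln_diagonal s A in
  [/\ 0 <= g,
      forall i, (\sum_j A i j - 1) ^+ 2 <= n.+2%:R ^+ 2 * g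
    & forall j, (\sum_i A i j - 1) ^+ 2 <= n.+2%:R ^+ 2 * g].
Proof.
move=> adM sM A g; have adA := sinkhorn_admissible k.+1 adM.
have sA : positive_diagonal A s by move=> i; rewrite sinkhorn_gt0.
have def_A2 : sinkhorn M k.+2 =
  if odd k.+1 then normalize_cols A else normalize_rows A by [].
(* For odd [k] the columns of [A] have just been normalized and the rows come next. *)
case: (boolP (odd k)) => ok.
  have Ac j : \sum_i A i j = 1 by exact: sinkhorn_col_sum.
  have [] := normalize_rows_defect adA sA Ac.
  rewrite -[normalize_rows A](_ : sinkhorn M k.+2 = _); last first.
    by rewrite def_A2 /= ok.
  rewrite -/g => g0 gr; split=> // j; rewrite Ac subrr expr0n.
  by rewrite mulr_ge0 ?sqr_ge0.
(* For even [k] the same argument applies to the transpose, with [s^-1] in place of [s]. *)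
have Ar i : \sum_j A i j = 1 by exact: sinkhorn_row_sum.
have sAt : positive_diagonal A^T s^-1.
  by move=> i; rewrite mxE -{2}[i](permKV s); exact: sA.
have Atc j : \sum_i A^T i j = 1.
  by rewrite -[RHS](Ar j); apply: eq_bigr => i _; rewrite mxE.
have [] := normalize_rows_defect (admissible_tr adA) sAt Atc.
rewrite -[normalize_rows A^T]trmxK -normalize_cols_tr !ln_diagonal_tr.
rewrite -[normalize_cols A](_ : sinkhorn M k.+2 = _); last first.
  by rewrite def_A2 /= ok.
rewrite -/g => g0 gr; split=> // [i|j].
  by rewrite Ar subrr expr0n mulr_ge0 ?sqr_ge0.
apply: le_trans (gr j); rewrite le_eqVlt; apply/orP; left; apply/eqP.
by congr ((_ - 1) ^+ 2); apply: eq_bigr => i _; rewrite mxE.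
Qed.

(** * Convergence of the iteration *)

Lemma sqr_dist_is_cvg (R : realType) (n : nat) (X : nat -> 'M[R]_n) (d : nat -> R) :
  d @ \oo --> 0 ->
  (forall k l i j, (X k i j - X l i j) ^+ 2 <= d k + d l) -> cvgn X.
Proof.
move=> d0 Xd; apply/cauchy_cvgP/cauchy_exP => e e0.
have e2 : 0 < e ^+ 2 / 2 by rewrite divr_gt0 ?exprn_gt0.
have := cvgr0_norm_lt _ d0 _ e2 => -[N _ dN].
exists (X N); exists N => // k Nk; split=> // i j; rewrite -ball_normE /=.
have lt_e (x : R) : x ^+ 2 < e ^+ 2 -> `|x| < e.
  by rewrite -ltr_sqrt ?exprn_gt0 // !sqrtr_sqr (gtr0_norm e0).
apply: lt_e; rewrite (le_lt_trans (Xd N k i j)) // [ltRHS]splitr ltrD //.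
  exact: le_lt_trans (ler_norm _) (dN N (leqnn N)).
exact: le_lt_trans (ler_norm _) (dN k Nk).
Qed.

Lemma cvg_bigsum (R : realType) (I : Type) (r : seq I) (P : pred I)
    (f : I -> nat -> R) (l : I -> R) :
  (forall i, P i -> f i @ \oo --> l i) ->
  (fun k => \sum_(i <- r | P i) f i k) @ \oo --> \sum_(i <- r | P i) l i.
Proof. move=> fl; by apply: cvg_big => [|i Pi]; [exact: add_continuous | exact: fl]. Qed.

Lemma cvg_mx_coord (R : realType) (n : nat) (X : nat -> 'M[R]_n) (A : 'M[R]_n) i j :
  X @ \oo --> A -> (fun k => X k i j) @ \oo --> A i j.
Proof.
move=> XA.
by apply: (@continuous_cvg _ _ _ _ _ X (fun B : 'M[R]_n => B i j) A) XA;
  exact: coord_continuous.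
Qed.

(** The logarithmic diagonal product is nondecreasing and at most 0, as entries are at most 1. Its
    increments therefore vanish, and up to a constant they bound the squared deviations. *)
Lemma sinkhorn_sums_cvg1 (R : realType) (n : nat) (M : 'M[R]_n) (s : 'S_n) :
  admissible M -> positive_diagonal M s ->
  exists2 d : nat -> R, d @ \oo --> 0 &
    forall k, (forall i, `|\sum_j sinkhorn M k.+1 i j - 1| <= d k) /\
              (forall j, `|\sum_i sinkhorn M k.+1 i j - 1| <= d k).
Proof.
move=> adM sM; pose G k := ln_diagonal s (sinkhorn M k.+1).
have cvgG : cvgn G.
  apply: nondecreasing_is_cvgn.
    apply/nondecreasing_seqP => k; rewrite -subr_ge0.
    by have [] := sinkhorn_defect k adM sM.
  exists 0 => _ [k _ <-]; apply: sumr_le0 => i _; apply: ln_le0.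
  by have /andP[] := sinkhorn_le1 k i (s i) adM.
pose g k := n.+2%:R ^+ 2 * (G k.+1 - G k).
have g0 : g @ \oo --> 0.
  rewrite -[X in _ --> X](mulr0 (n.+2%:R ^+ 2)) -(subrr (limn G)).
  apply: cvgM; first exact: cvg_cst.
  by apply: cvgB => //; rewrite cvg_shiftS.
exists (fun k => Num.sqrt (g k)).
  rewrite -[X in _ --> X](@sqrtr0 R).
  by apply: (@continuous_cvg _ _ _ _ _ g Num.sqrt 0) g0; exact: sqrt_continuous.
move=> k; have [_ gr gc] := sinkhorn_defect k adM sM.
by split=> [i|j]; rewrite -sqrtr_sqr ler_wsqrtr.
Qed.

(** On a positive diagonal through the entry, the logarithms are nonpositive and their sum never
    falls below its value at index 1; that value bounds each of them from below. *)
Lemma sinkhorn_lower_bound (R : realType) (n : nat) (M : 'M[R]_n) :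
  admissible M -> total_support M ->
  exists W, forall k i j, 0 < M i j -> - W <= ln (sinkhorn M k.+1 i j) <= 0.
Proof.
(* Summing over all permutations gives one bound for every entry. *)
move=> adM tsM; exists (\sum_(s : 'S_n) `|ln_diagonal s (sinkhorn M 1)|).
have ln0 k i j : ln (sinkhorn M k.+1 i j) <= 0.
  by rewrite ln_le0 //; have /andP[] := sinkhorn_le1 k i j adM.
move=> k i j /tsM [s sM <-]; rewrite ln0 andbT.
have Gk : ln_diagonal s (sinkhorn M 1) <= ln_diagonal s (sinkhorn M k.+1).
  elim: k => // k IH; apply: (le_trans IH); rewrite -subr_ge0.
  by have [] := sinkhorn_defect k adM sM.
apply: (@le_trans _ _ (ln_diagonal s (sinkhorn M 1))).
  rewrite lerNl (le_trans (ler_norm _)) // normrN (bigD1 s) //= lerDl.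
  by rewrite sumr_ge0.
apply: (le_trans Gk); rewrite /ln_diagonal (bigD1 i) //= gerDl.
by apply: sumr_le0 => a _; exact: ln0.
Qed.
Lemma sinkhorn_ln_scaled (R : realType) (n : nat) (M : 'M[R]_n) k :
  admissible M ->
  exists u v, forall i j, 0 < M i j ->
    ln (sinkhorn M k i j) - ln (M i j) = u i + v j.
Proof.
move=> adM; have [u [v AM]] := sinkhorn_scaled k adM.
exists u, v => i j Mij.
by rewrite AM lnM ?posrE ?expR_gt0 // expRK addrC addKr.
Qed.

(** Any two iterates are scalings of each other with uniformly bounded potentials, and their line
    sums differ by at most [d k + d l]; [scaled_sqrB_le] then yields the Cauchy property. *)
Lemma sinkhorn_is_cvg (R : realType) (n : nat) (M : 'M[R]_n) (s : 'S_n) :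
  admissible M -> total_support M -> positive_diagonal M s ->
  cvgn (fun k => sinkhorn M k.+1).
Proof.
move=> adM tsM sM; pose X k := sinkhorn M k.+1.
pose S i j := 0 < M i j.
have [W lnW] := sinkhorn_lower_bound adM tsM.
have [d d0 dX] := sinkhorn_sums_cvg1 adM sM.
have [P [Q PQ]] := potentials_linear_choice R S.
(* One bound for all the potentials [u] and [v] below, whatever the two iterates. *)
pose B := \sum_i \sum_a \sum_(b | S a b) W * (`|P i a b| + `|Q i a b|).
have W0 a b : S a b -> 0 <= W.
  by move=> Sab; have /andP[lo hi] := lnW 0%N a b Sab; rewrite -oppr_le0 (le_trans lo).
have term0 i a b : S a b -> 0 <= W * (`|P i a b| + `|Q i a b|).
  by move=> Sab; rewrite mulr_ge0 ?(W0 a b) ?addr_ge0.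
have B0 : 0 <= B by do 3!apply: sumr_ge0 => ? ?; exact: term0.
have Bi i : \sum_a \sum_(b | S a b) W * (`|P i a b| + `|Q i a b|) <= B.
  rewrite [leRHS](bigD1 i) //= lerDl.
  by do 3!apply: sumr_ge0 => ? ?; exact: term0.
have wW k l a b : S a b -> `|ln (X k a b) - ln (X l a b)| <= W.
  by move=> Sab; have := lnW k a b Sab; have := lnW l a b Sab; rewrite ler_norml /X; lra.
have sumB k l i (p : 'I_n -> 'I_n -> R) :
    (forall a b, `|p a b| <= `|P i a b| + `|Q i a b|) ->
    `|\sum_a \sum_(b | S a b) (ln (X k a b) - ln (X l a b)) * p a b| <= B.
  move=> pPQ; apply: le_trans (Bi i); apply: (le_trans (ler_norm_sum _ _ _)).
  apply: ler_sum => a _; apply: (le_trans (ler_norm_sum _ _ _)).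
  by apply: ler_sum => b Sab; rewrite normrM ler_pM // wW.
have sumd k l (r : nat -> R) : `|r k - 1| <= d k -> `|r l - 1| <= d l ->
    `|r k - r l| <= d k + d l.
  move=> rk rl; have -> : r k - r l = (r k - 1) - (r l - 1) by ring.
  by rewrite (le_trans (ler_normB _ _)) // lerD.
(* Each of the [n] rows and [n] columns contributes at most [B * (d k + d l)]. *)
apply: (@sqr_dist_is_cvg R n X (fun k => (B *+ n + B *+ n) * d k)).
  rewrite -[X in _ --> X](mulr0 (B *+ n + B *+ n)).
  by apply: cvgM => //; exact: cvg_cst.
move=> k l i j.
pose w a b := ln (X k a b) - ln (X l a b).
pose u i := \sum_a \sum_(b | S a b) w a b * P i a b.
pose v j := \sum_a \sum_(b | S a b) w a b * Q j a b.
have wuv a b : S a b -> w a b = u a + v b.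
  have [uk [vk Hk]] := sinkhorn_ln_scaled k.+1 adM.
  have [ul [vl Hl]] := sinkhorn_ln_scaled l.+1 adM.
  (* The potentials [uk - ul] and [vk - vl] may be unbounded; [PQ] trades them for [u] and [v]. *)
  apply: (PQ w (fun i => uk i - ul i) (fun j => vk j - vl j)) => {}a {}b Sab.
  have := Hk a b Sab; have := Hl a b Sab; rewrite /w /X; lra.
have Xuv a b : X k a b = X l a b * expR (u a + v b).
  case: (boolP (S a b)) => Sab.
    rewrite -wuv // expRD expRN !lnK ?posrE ?sinkhorn_gt0 //.
    by rewrite mulrCA divff ?mulr1 // gt_eqF // sinkhorn_gt0.
  have X0 m : X m a b = 0.
    have /andP[ge0 _] := sinkhorn_le1 m a b adM.
    by apply/eqP; rewrite eq_le ge0 andbT leNgt sinkhorn_gt0.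
  by rewrite !X0 mul0r.
have X01 m a b : 0 <= X m a b <= 1 by exact: sinkhorn_le1.
apply: le_trans (scaled_sqrB_le (X01 k) (X01 l) Xuv i j) _.
rewrite -mulrDr mulrDl !mulrnAl; apply: lerD.
  rewrite -[in leRHS](card_ord n) -sumr_const; apply: ler_sum => a _.
  apply: le_trans (ler_norm _) _; rewrite normrM ler_pM //.
    by apply: (sumB k l a) => b c; rewrite lerDl.
  by apply: (sumd k l (fun m => \sum_j X m a j)); have [] := dX k; have [] := dX l.
rewrite -[in leRHS](card_ord n) -sumr_const; apply: ler_sum => a _.
apply: le_trans (ler_norm _) _; rewrite normrM ler_pM //.
  by apply: (sumB k l a) => b c; rewrite lerDr.
by apply: (sumd k l (fun m => \sum_i X m i a)); have [] := dX k; have [] := dX l.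
Qed.

(** * The limit as a doubly stochastic scaling *)

Lemma cvg_squeeze_eq (R : realType) (f d : nat -> R) (a b : R) :
  d @ \oo --> 0 -> f @ \oo --> a -> (forall k, `|f k - b| <= d k) -> a = b.
Proof.
move=> d0 fa fd; apply/eqP; rewrite -subr_eq0 -normr_le0.
have fb : (fun k => `|f k - b|) @ \oo --> `|a - b|.
  by apply: cvg_norm; apply: cvgB => //; exact: cvg_cst.
by apply: (ler_cvg_to fb d0); exact: nearW.
Qed.

(** Positive entries stay above [expR (- W)], so their logarithms converge as well, and the linear
    choice of potentials passes to the limit. *)
Lemma sinkhorn_knopp (R : realType) (n : nat) (M : 'M[R]_n) (s : 'S_n) :
  admissible M -> total_support M -> positive_diagonal M s ->
  exists (A : 'M[R]_n) (u v : 'I_n -> R),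
    [/\ sinkhorn_limit M = A, doubly_stochastic A
      & forall i j, A i j = M i j * expR (u i + v j)].
Proof.
move=> adM tsM sM; pose X k := sinkhorn M k.+1.
have /cvg_ex[A XA] := sinkhorn_is_cvg adM tsM sM; rewrite -/X in XA.
pose S i j := 0 < M i j.
have [W lnW] := sinkhorn_lower_bound adM tsM.
have [d d0 dX] := sinkhorn_sums_cvg1 adM sM.
have [P [Q PQ]] := potentials_linear_choice R S.
have XAij i j : (fun k => X k i j) @ \oo --> A i j by exact: cvg_mx_coord.
have Agt0 i j : S i j -> 0 < A i j.
  move=> Sij; apply: (lt_le_trans (expR_gt0 (- W))).
  apply: (cvgr_to_ge (XAij i j)); apply: nearW => k.
  have /andP[lo _] := lnW k i j Sij.
  by rewrite -[leRHS]lnK ?posrE ?sinkhorn_gt0 // ler_expR.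
have Aeq0 i j : ~~ S i j -> A i j = 0.
  move=> nSij; apply: (cvg_unique _ (XAij i j)) => //.
  have -> : (fun k => X k i j) = fun=> 0.
    apply/funext => k; have /andP[ge0 _] := sinkhorn_le1 k i j adM.
    by apply/eqP; rewrite eq_le ge0 andbT leNgt sinkhorn_gt0.
  exact: cvg_cst.
pose w k i j := ln (X k i j) - ln (M i j).
pose wA i j := ln (A i j) - ln (M i j).
have wcvg i j : S i j -> (fun k => w k i j) @ \oo --> wA i j.
  move=> Sij; apply: cvgB; last exact: cvg_cst.
  apply: (@continuous_cvg _ _ _ _ _ (fun k => X k i j) (@ln R) (A i j)) (XAij i j).
  by apply: continuous_ln; exact: Agt0.
pose u i := \sum_a \sum_(b | S a b) wA a b * P i a b.
pose v j := \sum_a \sum_(b | S a b) wA a b * Q j a b.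
have sum_cvg (p : 'I_n -> 'I_n -> R) :
    (fun k => \sum_a \sum_(b | S a b) w k a b * p a b) @ \oo -->
    \sum_a \sum_(b | S a b) wA a b * p a b.
  apply: cvg_bigsum => a _; apply: cvg_bigsum => b Sab.
  by apply: cvgM; [exact: wcvg | exact: cvg_cst].
have wAuv i j : S i j -> wA i j = u i + v j.
  move=> Sij; apply: (cvg_unique _ (wcvg i j Sij)) => //.
  rewrite (_ : (fun k => w k i j) =
    (fun k => \sum_a \sum_(b | S a b) w k a b * P i a b +
              \sum_a \sum_(b | S a b) w k a b * Q j a b)).
    by apply: cvgD; exact: sum_cvg.
  apply/funext => k; have [uk [vk Hk]] := sinkhorn_ln_scaled k.+1 adM.
  exact: PQ Hk i j Sij.
have AM i j : A i j = M i j * expR (u i + v j).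
  case: (boolP (S i j)) => Sij.
    rewrite -wAuv // expRD expRN !lnK ?posrE ?Agt0 //.
    by rewrite mulrCA divff ?mulr1 // gt_eqF.
  rewrite Aeq0 //; have [M0 _ _] := adM.
  by have := M0 i j; rewrite le_eqVlt -/(S i j) (negbTE Sij) orbF => /eqP <-; rewrite mul0r.
exists A, u, v; split=> //.
  apply: cvg_lim; first exact: norm_hausdorff.
  (* Convergence is known for the sequence shifted by one, which has the same limit. *)
  by rewrite -cvg_shiftS.
split=> [|i|j]; first exact: scaled_admissible AM adM.
  apply: (cvg_squeeze_eq d0 (f := fun k => \sum_j X k i j)).
    by apply: cvg_bigsum => j _; exact: XAij.
  by move=> k; have [] := dX k.
apply: (cvg_squeeze_eq d0 (f := fun k => \sum_i X k i j)).
  by apply: cvg_bigsum => i _; exact: XAij.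
by move=> k; have [] := dX k.
Qed.

(** * Perturbation of the preimage *)

(** [C] is quantified before [L2] and [eps]; chosen after [M2], it would make the bound trivial for
    every positive [eps]. *)
Theorem proposition26 (R : realType) (n : nat) (L1 M1 : 'M[R]_n)
    (hL1 : doubly_stochastic L1)
    (hM1 : sinkhorn_preimage L1 M1)
    (hM1s : total_support M1) :
  exists C : R, forall (L2 : 'M[R]_n) (eps : R),
    doubly_stochastic L2 -> mxdist L1 L2 <= eps ->
    exists2 M2 : 'M[R]_n, sinkhorn_preimage L2 M2 & mxdist M1 M2 <= C * eps.
Proof.
have [[adM1 [s sM1]] limM1] := hM1.
have [A [u [v [limA _ AM1]]]] := sinkhorn_knopp adM1 hM1s sM1.
have {A limA AM1} M1L1 i j : M1 i j = L1 i j * expR (- u i - v j).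
  have -> : L1 = A by rewrite -limA; exact/esym/limM1.
  by rewrite AM1 -mulrA -expRD -opprD subrr expR0 mulr1.
(* The sum dominates every factor that takes an entry of [L1] to one of [M1]. *)
pose C : R := \sum_i \sum_j expR (- u i - v j).
have leC i j : expR (- u i - v j) <= C.
  rewrite /C (bigD1 i) //= (bigD1 j) //= -addrA lerDl.
  by rewrite addr_ge0 ?sumr_ge0 // => a _; rewrite ?sumr_ge0 // => *; exact: expR_ge0.
have C0 : 0 <= C by do 2!apply: sumr_ge0 => ? _; exact: expR_ge0.
exists C => L2 eps dsL2 dL.
pose M2 : 'M[R]_n := \matrix_(i, j) (L2 i j * expR (- u i - v j)).
have M2L2 i j : M2 i j = L2 i j * expR (- u i - v j) by rewrite mxE.
have [t tL2] := doubly_stochastic_positive_diagonal dsL2.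
have adM2 : admissible M2 by have [adL2 _ _] := dsL2; exact: scaled_admissible M2L2 adL2.
have tsM2 := scaled_total_support M2L2 (doubly_stochastic_total_support dsL2).
have tM2 : positive_diagonal M2 t by move=> i; rewrite (scaled_gt0 M2L2).
exists M2.
  split; first by split=> //; exists t.
  have [A [u' [v' [limA dsA AM2]]]] := sinkhorn_knopp adM2 tsM2 tM2.
  (* The limit [A] and [L2] are both doubly stochastic scalings of [M2], hence equal. *)
  rewrite /= limA; apply: (doubly_stochastic_scaled_eq dsA dsL2
    (u := fun i => u' i - u i) (v := fun j => v' j - v j)) => i j.
  by rewrite AM2 M2L2 -mulrA -expRD; congr (_ * expR _); ring.
(* The maximum in the norm starts from 0, whence the side condition [0 <= C * eps]. *)
have eps0 : 0 <= eps by rewrite (le_trans _ dL) // normr_ge0.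
rewrite /mxdist [leLHS]mx_normrE; apply/bigmax_leP; split=> [|[i j] _ /=].
  exact: mulr_ge0.
rewrite !mxE M1L1 -mulrBl normrM mulrC (ger0_norm (expR_ge0 _)) ler_pM ?expR_ge0 //.
apply: le_trans dL; rewrite /mxdist [leRHS]mx_normrE.
by apply/bigmax_geP; right; exists (i, j) => //=; rewrite !mxE.
Qed.
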